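(* Let $q$ be a power of a prime number, $A=\mathbb{F}_q[T]$, and let $\mathfrak{p}=(p(T))$ be a nonzero prime ideal of $A$ with $p(T)$ monic irreducible, $p(T)\neq T$, and $d=\deg_T p(T)$. Let $\alpha$ be a root of $p(T)$, let $\mathbb{F}_{\mathfrak{p}}=A/\mathfrak{p}=\mathbb{F}_q(\alpha)$, let $L$ be an extension field of $\mathbb{F}_{\mathfrak{p}}$, and let $\phi$ be any rank-$2$ Drinfeld module over $L$ defined by $\phi_T=\alpha+A_1\tau+A_2\tau^2$ ($A_1,A_2\in L$, $A_2\neq 0$). Then the following hold. (1) The coefficient $H_{\mathfrak{p}}^{(d)}(\phi)$ of $\tau^d$ in $\phi_{p(T)}$ is given by $$H_{\mathfrak{p}}^{(d)}(\phi)=\sum_{(S_1,S_2)\in P(d)} L(S_2+1)\,A_1^{w(S_1)}A_2^{w(S_2)}.$$ (2) When $A_1=\alpha+\lambda$ and $A_2=\lambda$ (with $\lambda$ an indeterminate), the polynomial $H_{\mathfrak{p}}^{(d)}(\lambda):=H_{\mathfrak{p}}^{(d)}(\phi)$ in $\lambda$ is separable, and its degree in $\lambda$ is $\deg_\lambda H_{\mathfrak{p}}^{(d)}(\lambda)=(q^d-1)/(q-1)$. Moreover, if $\lambda\in\overline{\mathbb{F}}_{\mathfrak{p}}$ satisfies $H_{\mathfrak{p}}^{(d)}(\lambda^{q+1})=0$, then $\lambda\in\mathbb{F}_{\mathfrak{p}}^{(2)}$.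
   Context: $L\{\tau\}$ is the twisted polynomial ring in the $q$-Frobenius $\tau$, with $\tau l=l^q\tau$ for $l\in L$. A rank-$2$ Drinfeld module over an extension $L$ of $\mathbb{F}_{\mathfrak{p}}$ is an $\mathbb{F}_q$-algebra homomorphism $\phi:A\to L\{\tau\}$, $a\mapsto\phi_a$, with $\phi_T=\alpha+A_1\tau+A_2\tau^2$, $A_1,A_2\in L$, $A_2\ne0$. Write $\phi_{p(T)}=\sum_{i=0}^{2d}g_i\tau^i$; then $H_{\mathfrak{p}}^{(d)}(\phi):=g_d$. $\overline{\mathbb{F}}_{\mathfrak{p}}$ is an algebraic closure of $\mathbb{F}_{\mathfrak{p}}$ and $\mathbb{F}_{\mathfrak{p}}^{(2)}$ is the quadratic extension of $\mathbb{F}_{\mathfrak{p}}$ in it (so it has $q^{2d}$ elements). Let $\mathbb{N}=\{0,1,2,\dots\}$. For $d>0$ put $\mathbb{N}_{<d}=\{0,1,\dots,d-1\}$. For a finite set $S\subset\mathbb{N}$ and $j>0$, $S+j=\{i+j\mid i\in S\}$ (so $\emptyset+j=\emptyset$). $P(d)$ is the set of ordered pairs $(S_1,S_2)$ of subsets of $\mathbb{N}_{<d}$ such that $S_1$, $S_2$, $S_2+1$ are pairwise disjoint with union $\mathbb{N}_{<d}$ (empty sets are allowed). For $n\in\mathbb{N}$, $[n]:=\alpha^{q^n}-\alpha$. For a finite $S\subset\mathbb{N}$, $L(S):=(-1)^{|S|}\prod_{i\in S}[i]$ (with $L(\emptyset)=1$; this function $L(\cdot)$ is not to be confused with the field $L$)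 and $w(S):=\sum_{i\in S}q^i$ (with $w(\emptyset)=0$). A polynomial is called separable if it has no multiple roots in an algebraic closure. *)

(* Defs.v *)
From HB Require Import structures.
From mathcomp Require Import all_boot all_order all_fingroup all_algebra.
From mathcomp Require Import all_solvable all_field finmap.

Set Implicit Arguments.
Unset Strict Implicit.
Unset Printing Implicit Defensive.

Import GRing.Theory.
Local Open Scope ring_scope.

(* L{tau} for an extension L of the finite field F, #|F| = q, given by the    *)
(* embedding j. An element sum_i f_i tau^i is stored as the polynomial with   *)
(* coefficients f_i; only the product differs from that of {poly L}. The      *)
(* embedding occurs in the type so that L{tau} is canonically an F-algebra.   *)
Definition twpoly (F : finFieldType) (L : fieldType) (j : {rmorphism F -> L}) :=
  {poly L}.

Section TwistedPolynomials.
Variables (F : finFieldType) (L : fieldType) (j : {rmorphism F -> L}).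
Local Notation q := #|F|.
Local Notation tw := (twpoly j).

HB.instance Definition _ := GRing.Zmodule.on tw.

Definition twcoef (f : tw) (i : nat) : L := (f : {poly L})`_i.

Definition twC (c : L) : tw := c%:P.

Definition tau : tw := 'X.

Definition twmul (f g : tw) : tw :=
  \poly_(n < size (f : {poly L}) + size (g : {poly L}))
    \sum_(i < n.+1) twcoef f i * twcoef g (n - i) ^+ (q ^ i).

Lemma twpolyP (f g : tw) : (forall i, twcoef f i = twcoef g i) -> f = g.
Proof. by move=> fg; apply/polyP. Qed.

Lemma card_pchar_nat i : [pchar L].-nat (q ^ i)%N.
Proof.
have [p p_pr pcharF] := finPcharP F.
rewrite (card_pprimeChar pcharF).
rewrite -expnM (eq_pnat _ (pcharf_eq (rmorph_pchar j pcharF))).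
by rewrite pnatX pnat_id.
Qed.

Lemma qexpD i (x y : L) : (x + y) ^+ (q ^ i) = x ^+ (q ^ i) + y ^+ (q ^ i).
Proof. exact/exprDn_pchar/card_pchar_nat. Qed.

Lemma qexp_gt0 i : (0 < q ^ i)%N.
Proof. by rewrite expn_gt0; apply/orP; left; apply/card_gt0P; exists 0. Qed.

Lemma qexp0 i : (0 : L) ^+ (q ^ i) = 0.
Proof. by rewrite expr0n -leqn0 leqNgt qexp_gt0. Qed.

Lemma qexp_sum i (I : Type) (r : seq I) (P : pred I) (E : I -> L) :
  (\sum_(k <- r | P k) E k) ^+ (q ^ i) = \sum_(k <- r | P k) E k ^+ (q ^ i).
Proof. exact: (big_morph _ (qexpD i) (qexp0 i)). Qed.

Lemma qexp_base i (c : F) : j c ^+ (q ^ i) = j c.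
Proof.
rewrite -rmorphXn /=; congr (j _).
by elim: i => [|i IHi]; rewrite ?expr1 // expnSr exprM IHi expf_card.
Qed.

Lemma twcoefM (f g : tw) n :
  twcoef (twmul f g) n =
    \sum_(i < n.+1) twcoef f i * twcoef g (n - i) ^+ (q ^ i).
Proof.
rewrite [LHS]coef_poly; case: ltnP => // le_fg_n.
apply/esym.
rewrite big1 // => i _; case: (ltnP i (size (f : {poly L}))) => [lt_i_f|le_f_i].
  rewrite [twcoef g _]nth_default ?qexp0 ?mulr0 //.
  have le_i_n : (i <= n)%N by rewrite -ltnS.
  by rewrite leq_subRL // (leq_trans _ le_fg_n) // leq_add2r ltnW.
by rewrite [twcoef f _]nth_default ?mul0r.
Qed.

Lemma twcoefD (f g : tw) n : twcoef (f + g) n = twcoef f n + twcoef g n.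
Proof. exact: coefD. Qed.

Lemma twcoefC c n : twcoef (twC c) n = if n == 0%N then c else 0.
Proof. exact: coefC. Qed.

Fact twmulA : associative twmul.
Proof.
move=> f g h; apply: twpolyP => n; rewrite !twcoefM.
pose G i k : L :=
  twcoef f i * twcoef g k ^+ (q ^ i) * twcoef h (n - (i + k)) ^+ (q ^ (i + k)).
transitivity (\sum_(i < n.+1) \sum_(k < (n - i).+1) G i k).
  apply: eq_bigr => i _; rewrite twcoefM qexp_sum big_distrr /=.
  apply: eq_bigr => k _; rewrite exprMn mulrA -exprM -expnD.
  by rewrite -subnDA (addnC k).
transitivity
  (\sum_(m < n.+1) \sum_(i < n.+1 | (i <= m)%N) G i (m - i)%N); last first.
  apply: eq_bigr => m _; rewrite twcoefM big_distrl /=.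
  pose E i := twcoef f i * twcoef g (m - i) ^+ (q ^ i)
              * twcoef h (n - m) ^+ (q ^ m).
  rewrite (big_ord_widen n.+1 E) //.
  apply: eq_big => // i; rewrite -ltnS => le_i_m.
  by rewrite /G subnKC.
rewrite [RHS](exchange_big_dep predT) //=; apply: eq_bigr => i _.
have le_i_n : (i <= n)%N by rewrite -ltnS.
rewrite -(big_mkord (fun m => (i <= m)%N) (fun m => G i (m - i)%N)).
rewrite -(@big_nat_widenl _ _ _ i 0 n.+1 predT) //.
rewrite -[X in index_iota X]add0n big_addn subSn // big_mkord.
by apply: eq_bigr => k _; rewrite addnK.
Qed.

Fact twmul1 : left_id (twC 1) twmul.
Proof.
move=> f; apply: twpolyP => n; rewrite twcoefM big_ord_recl big1 => [|i _].
  by rewrite twcoefC mul1r subn0 expr1 addr0.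
by rewrite twcoefC mul0r.
Qed.

Fact twmulr1 : right_id (twC 1) twmul.
Proof.
move=> f; apply: twpolyP => n; rewrite twcoefM big_ord_recr big1 => [|i _] /=.
  by rewrite subnn twcoefC expr1n mulr1 add0r.
by rewrite twcoefC -[_ == _]negbK -lt0n subn_gt0 ltn_ord qexp0 mulr0.
Qed.

Fact twmulDl : left_distributive twmul +%R.
Proof.
move=> f g h; apply: twpolyP => n; rewrite twcoefD !twcoefM -big_split /=.
by apply: eq_bigr => i _; rewrite twcoefD mulrDl.
Qed.

Fact twmulDr : right_distributive twmul +%R.
Proof.
move=> f g h; apply: twpolyP => n; rewrite twcoefD !twcoefM -big_split /=.
by apply: eq_bigr => i _; rewrite twcoefD qexpD mulrDr.
Qed.

Fact tw1_neq0 : twC 1 != 0.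
Proof. by rewrite polyC_eq0 oner_neq0. Qed.

HB.instance Definition _ := GRing.Zmodule_isNzRing.Build tw
  twmulA twmul1 twmulr1 twmulDl twmulDr tw1_neq0.

Definition twscale (c : F) (f : tw) : tw := j c *: (f : {poly L}).

Lemma twcoefZ c f n : twcoef (twscale c f) n = j c * twcoef f n.
Proof. exact: coefZ. Qed.

Fact twscaleA a b f : twscale a (twscale b f) = twscale (a * b) f.
Proof. by rewrite /twscale scalerA rmorphM. Qed.

Fact twscale1 : left_id 1 twscale.
Proof. by move=> f; rewrite /twscale rmorph1 scale1r. Qed.

Fact twscaleDr : right_distributive twscale +%R.
Proof. by move=> a f g; exact: scalerDr. Qed.

Fact twscaleDl f : {morph twscale^~ f : a b / a + b}.
Proof. by move=> a b; rewrite /twscale rmorphD; exact: scalerDl. Qed.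

HB.instance Definition _ := GRing.Zmodule_isLmodule.Build F tw
  twscaleA twscale1 twscaleDr twscaleDl.

Fact twscaleAl (a : F) (f g : tw) : a *: (f * g) = (a *: f) * g.
Proof.
apply: twpolyP => n; rewrite [LHS]twcoefZ !twcoefM big_distrr /=.
by apply: eq_bigr => i _; rewrite [in RHS]twcoefZ mulrA.
Qed.

HB.instance Definition _ := GRing.Lmodule_isLalgebra.Build F tw twscaleAl.

Fact twscaleAr (a : F) (f g : tw) : a *: (f * g) = f * (a *: g).
Proof.
apply: twpolyP => n; rewrite [LHS]twcoefZ !twcoefM big_distrr /=.
apply: eq_bigr => i _; rewrite [in RHS]twcoefZ exprMn qexp_base.
by rewrite mulrCA.
Qed.

HB.instance Definition _ := GRing.Lalgebra_isAlgebra.Build F tw twscaleAr.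

Lemma tau_twC (l : L) : tau * twC l = twC (l ^+ q) * tau.
Proof.
apply: twpolyP => n; rewrite !twcoefM.
have tauE k : twcoef tau k = (k == 1%N)%:R by exact: coefX.
case: n => [|n].
  by rewrite !big_ord1 !tauE mul0r mulr0.
rewrite (bigD1 (1 : 'I_n.+2)) //= big1 ?addr0; last first.
  by move=> i; rewrite tauE -val_eqE /= => /negPf->; rewrite mul0r.
rewrite big_ord_recl big1 ?addr0; last by move=> i _; rewrite twcoefC mul0r.
rewrite !tauE !twcoefC eqxx mul1r expn1 expr1 subn1 subn0 /= eqSS.
by case: n => [|n] /=; rewrite ?mulr1 ?mulr0 // -[q]expn1 qexp0.
Qed.

(* phi : F[T] -> L{tau} is the rank 2 Drinfeld module with                    *)
(* phi_T = alpha + A1 tau + A2 tau^2.                                         *)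
Definition drinfeld_rank2 (alpha A1 A2 : L)
    (phi : {lrmorphism {poly F} -> tw}) : Prop :=
  A2 != 0 /\ phi 'X = twC alpha + twC A1 * tau + twC A2 * tau ^+ 2.

(* H_p^(d)(phi), where d = deg p *)
Definition Hcoef (p : {poly F}) (phi : {lrmorphism {poly F} -> tw}) : L :=
  twcoef (phi p) (size p).-1.

End TwistedPolynomials.

Section Combinatorics.
Local Open Scope fset_scope.

Definition nat_lt (d : nat) : {fset nat} := [fset i | i in iota 0 d].

Definition fshift (S : {fset nat}) (k : nat) : {fset nat} :=
  [fset (i + k)%N | i in S].

Definition Ppairs (d : nat) : {fset {fset nat} * {fset nat}} :=
  [fset S in fpowerset (nat_lt d) `*` fpowerset (nat_lt d) |
    [&& [disjoint S.1 & S.2]%fset, [disjoint S.1 & fshift S.2 1]%fset,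
        [disjoint S.2 & fshift S.2 1]%fset
      & S.1 `|` S.2 `|` fshift S.2 1 == nat_lt d]].

End Combinatorics.

Definition brak (L : fieldType) (q : nat) (alpha : L) (n : nat) : L :=
  alpha ^+ (q ^ n) - alpha.

Definition Lprod (L : fieldType) (q : nat) (alpha : L) (S : {fset nat}) : L :=
  (-1) ^+ #|` S| * \prod_(i <- S) brak q alpha i.

Definition wt (q : nat) (S : {fset nat}) : nat := (\sum_(i <- S) q ^ i)%N.

Definition alg_closure (k : fieldType) (K : closedFieldType)
    (iota : {rmorphism k -> K}) : Prop :=
  forall x : K, algebraicOver iota x.

Definition no_multiple_root (k : fieldType) (f : {poly k}) : Prop :=
  forall (K : closedFieldType) (iota : {rmorphism k -> K}),
    alg_closure iota ->
    forall x : K, ~~ (('X - x%:P) ^+ 2 %| map_poly iota f).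

(* x lies in a quadratic extension of k inside K. For k finite and K an       *)
(* algebraic closure of k there is exactly one such extension.                *)
Definition in_quadratic_ext (k : fieldType) (K : fieldType)
    (iota : {rmorphism k -> K}) (x : K) : Prop :=
  exists (E : fieldExtType k) (e : {rmorphism E -> K}),
    [/\ \dim {:E} = 2%N, forall c : k, e c%:A = iota c & exists y, x = e y].

(* Main.v *)
Require Import Defs.
From HB Require Import structures.
From mathcomp Require Import all_boot all_order all_fingroup all_algebra.
From mathcomp Require Import all_solvable all_field finmap.
From mathcomp Require Import zify ring.

Set Implicit Arguments.
Unset Strict Implicit.
Unset Printing Implicit Defensive.

Import GRing.Theory.
Local Open Scope ring_scope.

(* Part (1).  Extend f |-> phi_f to a left L-linear map ev on L[T] by letting *)
(* T act as right multiplication by phi_T.  The coefficient of tau^n in       *)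
(* ev((T - alpha^(q^n)) f) only involves the coefficients of tau^(n-1) and    *)
(* tau^(n-2) in ev(f).  As p is the product of the T - alpha^(q^i) over       *)
(* 0 < i <= d, this yields g_d for the recursion                              *)
(*   g_0 = 1, g_1 = A1,                                                       *)
(*   g_(k+2) = A1^(q^(k+1)) g_(k+1) - [k+1] A2^(q^k) g_k,                     *)
(* which is also the recursion of the sum over P(d), split according to       *)
(* whether d-1 lies in S1 or in S2 + 1.                                       *)
(*                                                                            *)
(* Separability.  From k = 1 on, the derivatives g_k' satisfy the recursion   *)
(* of the g_k, because the derivatives of q-th powers vanish; hence the       *)
(* Casoratian g_(k+1) g_k' - g_(k+1)' g_k is a nonzero monomial in lambda,    *)
(* while g_d(0) <> 0.                                                         *)
(*                                                                            *)
(* Field of definition.  With s = lambda^(q+1), phi_T = N M for               *)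
(* N = alpha + s tau and M = 1 + tau.  In the supersingular case              *)
(* p(N M) = c tau^(2d), where c is a power of s; comparing coefficients of    *)
(* tau^(2d) in M p(N M) = p(M N) M gives c = c^q, that is,                    *)
(* lambda^(q^(2d)) = lambda.                                                  *)

(** * The sum over P(d) as a second order recursion *)

(** Both sides of part (1) are identified with [hasse_rec]: the coefficient g_d by [ev_prod_hasse]
    and [Hcoef_hasse_rec], the sum over P(d) by [sum_Ppairs]. Run with polynomial coefficients, the
    same recursion is the polynomial in lambda. Its first term dominates, which gives the degree 1 +
    q + ... + q^(d-1) ([size_hasse_poly]). The brackets [i] for 0 < i < d are nonzero because no
    smaller power of Frobenius fixes alpha ([brak_neq0]); this makes the Casoratian nonzero. For the
    last claim, phi_p commutes with phi_T, so once its coefficients at tau^0 and tau^d vanish, all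
    those below tau^(2d) do ([twcoef_commute_low]). Then [supersingular_qpow_fixed] compares leading
    coefficients, and [qpow2_in_quadratic_ext] turns the resulting equation into membership in an
    extension of degree two. *)

Fixpoint hasse_rec (R : pzRingType) (q : nat) (a x y : R) (n : nat) : R :=
  match n with
  | 0 => 1
  | m.+1 => match m with
    | 0 => x
    | k.+1 => x ^+ (q ^ m) * hasse_rec q a x y m
              - (a ^+ (q ^ m) - a) * y ^+ (q ^ k) * hasse_rec q a x y k
    end
  end.

Arguments hasse_rec : simpl never.

Lemma hasse_recSS (R : pzRingType) q (a x y : R) k :
  hasse_rec q a x y k.+2 = x ^+ (q ^ k.+1) * hasse_rec q a x y k.+1
    - (a ^+ (q ^ k.+1) - a) * y ^+ (q ^ k) * hasse_rec q a x y k.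
Proof. by []. Qed.

Lemma nat_ind2 (P : nat -> Prop) :
  P 0%N -> P 1%N -> (forall k, P k -> P k.+1 -> P k.+2) -> forall n, P n.
Proof.
move=> P0 P1 PSS n; suff: P n /\ P n.+1 by case.
by elim: n => // n [Pn Pn1]; split=> //; apply: PSS.
Qed.

(** Naturality is why the recursion is stated over an arbitrary ring: one polynomial over Fp then
    serves the fraction field and every specialization in an algebraic closure. *)
Lemma rmorph_hasse_rec (R S : pzRingType) (f : {rmorphism R -> S}) q a x y n :
  f (hasse_rec q a x y n) = hasse_rec q (f a) (f x) (f y) n.
Proof.
elim/nat_ind2: n => [|//|k IHk IHk1]; first exact: rmorph1.
by rewrite !hasse_recSS !(rmorphB, rmorphM, rmorphXn) /= IHk IHk1.
Qed.

Section PairSum.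
Local Open Scope fset_scope.

Lemma in_nat_lt d i : (i \in nat_lt d) = (i < d)%N.
Proof. by rewrite /nat_lt !inE /= mem_iota. Qed.

Lemma in_fshift1 (S : {fset nat}) i :
  (i \in fshift S 1) = (0 < i)%N && (i.-1 \in S).
Proof.
apply/imfsetP/andP => [[k /= kS ->]|[i_gt0 iS]]; first by rewrite addn1.
by exists i.-1 => //=; rewrite addn1 prednK.
Qed.

(** Disjointness and covering together say that each i < d is counted exactly once and every other i
    never. In this numerical form, membership is settled by Boolean case analysis at each point. *)
Lemma in_Ppairs d (S : {fset nat} * {fset nat}) :
  reflect (forall i, ((i \in S.1) + (i \in S.2) + (i \in fshift S.2 1)
                     = (i < d) :> nat)%N)
    (S \in Ppairs d).
Proof.
rewrite !inE /= !fpowersetE; apply: (iffP idP) => [|cov].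
  case/andP => _ /and4P[/fdisjointP d12 /fdisjointP d13 /fdisjointP d23].
  move=> /eqP/fsetP cov i; move: (cov i) (d12 i) (d13 i) (d23 i).
  rewrite in_nat_lt !in_fsetU.
  do 3?[case: (_ \in _)] => /= <- // H1 H2 H3;
    first [by have := H1 isT | by have := H2 isT | by have := H3 isT].
have sub12 i : (i \in S.1) || (i \in S.2) -> i \in nat_lt d.
  by rewrite in_nat_lt; have := cov i; do 4?case: (_ \in _) => //=; case: ltnP.
apply/andP; split.
  by apply/andP; split; apply/fsubsetP => i Si; apply: sub12; rewrite Si ?orbT.
apply/and4P; split; last first.
  apply/eqP/fsetP => i; rewrite !in_fsetU in_nat_lt; have := cov i.
  by do 3?case: (_ \in _) => //=; case: ltnP.
all: apply/fdisjointP => i Si; have := cov i; rewrite Si.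
all: by do 2?case: (_ \in _) => //=; case: ltnP.
Qed.

Lemma Ppairs0 : perm_eq (Ppairs 0) [:: (fset0, fset0)].
Proof.
apply: uniq_perm => // S; rewrite mem_seq1; apply/in_Ppairs/eqP => [cov|-> i].
  by apply/eqP; case: S cov => S1 S2 /= cov; rewrite xpair_eqE;
    apply/andP; split; apply/eqP/fsetP => i; rewrite inE;
    have := cov i; case: (_ \in S1); case: (_ \in S2).
by rewrite in_fshift1 !inE andbF.
Qed.

Lemma Ppairs1 : perm_eq (Ppairs 1) [:: ([fset 0%N], fset0)].
Proof.
apply: uniq_perm => // S; rewrite mem_seq1; apply/in_Ppairs/eqP => [cov|-> i].
  have S2_0 i : i \in S.2 = false.
    have := cov i.+1; rewrite in_fshift1 /=.
    by case: (i \in S.2) => //; rewrite addn1.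
  have S2E : S.2 = fset0 by apply/fsetP => i; rewrite S2_0 inE.
  rewrite [LHS]surjective_pairing S2E; congr pair; apply/fsetP => i.
  have := cov i; rewrite S2E in_fshift1 !inE andbF !addn0.
  by case: i => [|i] /=; case: (_ \in S.1).
by rewrite in_fshift1 !inE andbF !addn0 ltnS leqn0.
Qed.

(** A pair in P(d) is a tiling of 0, ..., d-1 by single cells (the points of S1) and dominoes (with
    left ends in S2). [Padd1] appends a cell on the right, [Padd2] a domino. *)
Definition Padd1 d (S : {fset nat} * {fset nat}) := (d |` S.1, S.2).
Definition Padd2 d (S : {fset nat} * {fset nat}) := (S.1, d |` S.2).

Lemma Ppairs_notin d S k : S \in Ppairs d -> (d <= k)%N ->
  [/\ k \in S.1 = false, k \in S.2 = false & k \in fshift S.2 1 = false].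
Proof.
move=> /in_Ppairs/(_ k) + le_dk; rewrite ltnNge le_dk /=.
by do 3!case: (_ \in _).
Qed.

Lemma Ppairs_notin2 d S : S \in Ppairs d.+1 -> d \in S.2 = false.
Proof.
by move=> PS; have [_ _] := Ppairs_notin PS (leqnn _); rewrite in_fshift1.
Qed.

Lemma Padd1_in d S : S \in Ppairs d.+1 -> Padd1 d.+1 S \in Ppairs d.+2.
Proof.
move=> PS; have [n1 n2 n3] := Ppairs_notin PS (leqnn _).
move/in_Ppairs: PS => cov; apply/in_Ppairs => i /=; rewrite !in_fset1U.
have [->|ni] := eqVneq i d.+1; first by rewrite n2 n3 ltnSn.
by rewrite /= cov [in RHS]ltnS [in RHS]leq_eqVlt (negPf ni).
Qed.

Lemma Padd2_in d S : S \in Ppairs d -> Padd2 d S \in Ppairs d.+2.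
Proof.
move=> PS; have [n1 n2 n3] := Ppairs_notin PS (leqnn _).
have [m1 m2 m3] := Ppairs_notin PS (leqnSn _).
move/in_Ppairs: PS => cov; apply/in_Ppairs => i /=.
have [->|ni] := eqVneq i d.+1.
  by rewrite in_fshift1 !in_fset1U /= m1 m2 eqxx gtn_eqF // ltnSn.
have [->|nd] := eqVneq i d.
  rewrite n1 in_fset1U eqxx in_fshift1 in_fset1U /= ltnS leqnSn.
  move: n3; rewrite in_fshift1; case: (posnP d) => [->//|d_gt0] /= ->.
  by rewrite orbF ltn_eqF // prednK.
rewrite in_fshift1 !in_fset1U (negPf nd).
rewrite [in RHS]ltnS [in RHS]leq_eqVlt (negPf ni) /=.
rewrite [in RHS]ltnS [in RHS]leq_eqVlt (negPf nd) -cov in_fshift1.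
by case: i ni {nd} => //= i; rewrite eqSS => /negPf ->.
Qed.

(** The last point d+1 cannot lie in S2, since d+2 would then be covered. So it is a single cell, or
    the right half of a domino starting at d; removing that tile leaves a shorter tiling. *)
Lemma Ppairs_split d S : S \in Ppairs d.+2 ->
  (exists2 S', S' \in Ppairs d.+1 & S = Padd1 d.+1 S')
  \/ (exists2 S', S' \in Ppairs d & S = Padd2 d S').
Proof.
move=> PS; have S2d1 := Ppairs_notin2 PS.
move/in_Ppairs: PS => cov.
have := cov d.+1; rewrite S2d1 in_fshift1 /= addn0 ltnSn.
case S1d1: (d.+1 \in S.1); case S2d: (d \in S.2) => // _; [left|right].
  exists (S.1 `\ d.+1, S.2); last first.
    by rewrite /Padd1 /= fsetD1K //; case: (S).
  apply/in_Ppairs => i /=; rewrite in_fsetD1.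
  have [->|ni] := eqVneq i d.+1; first by rewrite S2d1 in_fshift1 /= S2d ltnn.
  by rewrite /= cov ltnS leq_eqVlt (negPf ni).
exists (S.1, S.2 `\ d); last by rewrite /Padd2 /= fsetD1K //; case: (S).
apply/in_Ppairs => i /=; rewrite in_fshift1 !in_fsetD1.
have [->|ni] := eqVneq i d.+1.
  by rewrite S1d1 S2d1 /= eqxx /= andbF ltnNge leqnSn.
have [->|nd] := eqVneq i d.
  have := cov d; rewrite S2d in_fshift1 ltnS leqnSn ltnn.
  case: (d \in S.1) => //=; case: (posnP d) => [->//|d_gt0] /=.
  by case: (_.-1 \in S.2); rewrite ?andbF.
have := cov i; rewrite in_fshift1 ltnS (leq_eqVlt i) (negPf ni) /=.
rewrite ltnS (leq_eqVlt i) (negPf nd) /= => <-.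
by case: i ni {nd} => //= i; rewrite eqSS => /negPf ->.
Qed.

Lemma PpairsSS d : perm_eq (Ppairs d.+2)
  (map (Padd1 d.+1) (Ppairs d.+1) ++ map (Padd2 d) (Ppairs d)).
Proof.
apply: uniq_perm => //.
  rewrite cat_uniq !map_inj_in_uniq ?fset_uniq /= ?andbT.
  - apply/hasPn => _ /mapP[S PS ->]; apply/mapP => -[S' PS'] [_ S2].
    have := Ppairs_notin2 PS'; rewrite -S2.
    by rewrite in_fset1U eqxx.
  - move=> [S1 S2] [S1' S2'] PS PS' [E1 E2].
    have [_ n2 _] := Ppairs_notin PS (leqnn _).
    have [_ n2' _] := Ppairs_notin PS' (leqnn _).
    by rewrite E1 -[S2](fsetU1K (negbT n2)) -[S2'](fsetU1K (negbT n2')) E2.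
  move=> [S1 S2] [S1' S2'] PS PS' [E1 E2].
  have [n1 _ _] := Ppairs_notin PS (leqnn _).
  have [n1' _ _] := Ppairs_notin PS' (leqnn _).
  by rewrite E2 -[S1](fsetU1K (negbT n1)) -[S1'](fsetU1K (negbT n1')) E1.
move=> S; rewrite mem_cat; apply/idP/orP.
  by case/Ppairs_split=> -[S' PS' ->]; [left|right]; apply: map_f.
by case=> /mapP[S' PS' ->]; [apply: Padd1_in|apply: Padd2_in].
Qed.

Lemma wtU1 q k (S : {fset nat}) : k \notin S ->
  wt q (k |` S) = (q ^ k + wt q S)%N.
Proof. by move=> kS; rewrite /wt big_fsetU1. Qed.

Lemma fshiftU1 k (S : {fset nat}) : fshift (k |` S) 1 = k.+1 |` fshift S 1.
Proof.
apply/fsetP => i; rewrite in_fset1U !in_fshift1 in_fset1U.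
by case: i => //= i; rewrite eqSS.
Qed.

Lemma LprodU1 (L : fieldType) q (a : L) k (S : {fset nat}) : k \notin S ->
  Lprod q a (k |` S) = - brak q a k * Lprod q a S.
Proof.
move=> kS; rewrite /Lprod cardfsU1 kS big_fsetU1 //= exprS.
by rewrite mulN1r !mulNr mulrCA.
Qed.

Lemma sum_Ppairs (L : fieldType) q (a x y : L) d :
  (\sum_(S <- Ppairs d)
     Lprod q a (fshift S.2 1) * x ^+ wt q S.1 * y ^+ wt q S.2)%R
  = hasse_rec q a x y d.
Proof.
have shift0 : fshift fset0 1 = fset0.
  by apply/fsetP => i; rewrite in_fshift1 !inE andbF.
elim/nat_ind2: d => [||d IHd IHd1].
- rewrite (perm_big _ Ppairs0) big_seq1 /= shift0 /Lprod /wt cardfs0.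
  by rewrite !big_seq_fset0 !expr0 !mulr1.
- rewrite (perm_big _ Ppairs1) big_seq1 /= shift0 /Lprod /wt cardfs0.
  by rewrite !big_seq_fset0 big_seq_fset1 !expr0 !mulr1 mul1r.
rewrite (perm_big _ (PpairsSS d)) big_cat !big_map hasse_recSS -IHd -IHd1.
rewrite !big_distrr /= -sumrN; congr +%R; apply: eq_big_seq => S PS.
  have [n1 _ _] := Ppairs_notin PS (leqnn _).
  by rewrite wtU1 ?n1 // exprD; ring.
have [_ n2 _] := Ppairs_notin PS (leqnn _).
have [_ _ m3] := Ppairs_notin PS (leqnSn _).
rewrite fshiftU1 LprodU1 ?m3 // wtU1 ?n2 // exprD /brak; ring.
Qed.

End PairSum.

(** * Conjugates of a root over the finite base field *)

(* [j] is a phantom argument: it witnesses that [L] contains [F], which makes *)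
(* the power map additive.                                                    *)
Definition qpow (F : finFieldType) (L : fieldType) (j : {rmorphism F -> L})
  (n : nat) (x : L) : L := x ^+ (#|F| ^ n).

Section PowerMap.
Variables (F : finFieldType) (L : fieldType) (j : {rmorphism F -> L}) (n : nat).

Fact qpow_nmod : nmod_morphism (qpow j n).
Proof. by split; [exact: qexp0|exact: (qexpD j)]. Qed.

Fact qpow_monoid : monoid_morphism (qpow j n).
Proof. by split=> [|x y]; rewrite /qpow ?expr1n ?exprMn. Qed.

HB.instance Definition _ := GRing.isNmodMorphism.Build L L (qpow j n) qpow_nmod.
HB.instance Definition _ :=
  GRing.isMonoidMorphism.Build L L (qpow j n) qpow_monoid.
End PowerMap.

Lemma map_poly_descent (k K : fieldType) (iota : {rmorphism k -> K})
    (f : {poly K}) :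
  (forall i, exists c, f`_i = iota c) -> exists r, f = map_poly iota r.
Proof.
elim/poly_ind: f => [|f c IHf] f_iota; first by exists 0; rewrite rmorph0.
have [i|r ->] := IHf.
  have := f_iota i.+1; rewrite coefD coefMX coefC /= addr0; exact.
have := f_iota 0%N; rewrite coefD coefMX coefC /= add0r => -[b ->].
by exists (r * 'X + b%:P); rewrite rmorphD rmorphM /= map_polyX map_polyC.
Qed.

Lemma fixed_pow_descent (k K : fieldType) (iota : {rmorphism k -> K}) n
    (s : seq k) (x : K) :
  'X^n - 'X = \prod_(c <- s) ('X - c%:P) -> x ^+ n = x ->
  exists c, x = iota c.
Proof.
move=> gen xn; have : root (map_poly iota ('X^n - 'X)) x.
  by rewrite rmorphB /= map_polyXn map_polyX /root !hornerE xn subrr.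
rewrite gen rmorph_prod /root horner_prod prodf_seq_eq0 => /hasP[c _].
by rewrite /= rmorphB /= map_polyX map_polyC -rootE root_XsubC => /eqP ->; exists c.
Qed.

Section ConjugateRoots.
Variables (F : finFieldType) (p : {poly F}).
Hypotheses (p_monic : p \is monic) (p_irr : irreducible_poly p).
Variables (K : fieldExtType F) (a : K).
Hypotheses (pa0 : root (map_poly (GRing.in_alg K) p) a)
  (K_gen : <<1; a>>%VS = {:K}%VS).
Local Notation q := #|F|.
Local Notation d := (size p).-1.

Lemma irreducible_dvdp_root (r : {poly F}) :
  root (map_poly (GRing.in_alg K) r) a -> p %| r.
Proof.
move=> ra0; apply: contraT; rewrite -irreducible_poly_coprime // => co_pr.
have := @coprimep_root _ (map_poly (GRing.in_alg K) p)
  (map_poly (GRing.in_alg K) r) a.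
by rewrite coprimep_map (rootP ra0) eqxx => /(_ co_pr pa0).
Qed.

Lemma dim_irreducible : \dim {:K} = d.
Proof.
have := dim_Fadjoin 1 a; rewrite K_gen dimv1 muln1 => ->.
apply: eq_add_S; rewrite -size_minPoly.
have /polyOver1P[r rE] := minPolyOver 1 a.
have pr : p %| r by apply: irreducible_dvdp_root; rewrite -rE root_minPoly.
have rp : r %| p.
  rewrite -(dvdp_map (GRing.in_alg K)) -rE; apply: minPoly_dvdp => //.
  by apply/polyOver1P; exists p.
rewrite rE size_map_poly prednK; first by apply: eqp_size; rewrite /eqp rp pr.
by case: p_irr => /ltnW.
Qed.

Lemma root_qpow_period : a ^+ (q ^ d) = a.
Proof.
by apply/eqP; rewrite -dim_irreducible -Fermat's_little_theorem memvf.
Qed.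

(** Frobenius permutes the factors cyclically over a full period, so the coefficients of the product
    are fixed by the q-power map and hence lie in F. *)
Lemma qpow_period_descent m : a ^+ (q ^ m) = a ->
  exists r : {poly F}, \prod_(i < m) ('X - (a ^+ (q ^ i))%:P)
                       = map_poly (GRing.in_alg K) r.
Proof.
move=> am; set P := \prod_(i < m) _.
have frobP : map_poly (qpow (GRing.in_alg K) 1) P = P.
  rewrite rmorph_prod /=.
  under eq_bigr => i _ do
    rewrite rmorphB /= map_polyX map_polyC /= /qpow -exprM -expnD addn1.
  case: m am @P => [|m] am P; first by rewrite /P !big_ord0.
  by rewrite /P big_ord_recr /= am big_ord_recl /= expr1 mulrC.
apply: map_poly_descent => i.
have := fixed_pow_descent (GRing.in_alg K) (finField_genPoly F).
by apply; rewrite -[in RHS]frobP coef_map_id0 /qpow ?expn1 // expr0n gtn_eqF //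
  (cardD1 0) inE.
Qed.

(** A positive period m yields a polynomial of degree m over F vanishing at a, which p must
    divide. *)
Lemma qpow_period_ge m : (0 < m)%N -> a ^+ (q ^ m) = a -> (d <= m)%N.
Proof.
move=> m_gt0 am; have [r rE] := qpow_period_descent am.
have size_r : size r = m.+1.
  rewrite -(size_map_poly (GRing.in_alg K)) -rE size_prod_XsubC.
  by rewrite -[index_enum _]enumT size_enum_ord.
suff /dvdp_leq: p %| r.
  by rewrite -size_poly_gt0 size_r => /(_ isT); case: (size p).
apply: irreducible_dvdp_root; rewrite -rE.
case: m m_gt0 {am rE size_r} => // m _.
by rewrite big_ord_recl rootM expr1 root_XsubC eqxx.
Qed.

Lemma irreducible_qpow_factor :
  map_poly (GRing.in_alg K) p = \prod_(i < d) ('X - (a ^+ (q ^ i))%:P).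
Proof.
have [r rE] := qpow_period_descent root_qpow_period.
have size_r : size r = size p.
  rewrite -(size_map_poly (GRing.in_alg K)) -rE size_prod_XsubC.
  rewrite -[index_enum _]enumT size_enum_ord prednK //.
  by case: p_irr => /ltnW.
have r_monic : r \is monic.
  by rewrite -(map_monic (GRing.in_alg K)) -rE monic_prod_XsubC.
rewrite rE; congr (map_poly _ _); apply/eqP; rewrite -eqp_monic //.
rewrite -dvdp_size_eqp ?size_r //; apply: irreducible_dvdp_root; rewrite -rE.
case: p_irr; case: (size p) => [|[|m]] //= _ _.
by rewrite big_ord_recl rootM expr1 root_XsubC eqxx.
Qed.

Lemma brak_neq0 m : (0 < m < d)%N -> brak q a m != 0.
Proof.
case/andP=> m_gt0; apply: contraL => /eqP/subr0_eq/(qpow_period_ge m_gt0).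
by rewrite -leqNgt.
Qed.

End ConjugateRoots.

(** * Coefficients of twisted polynomials *)

Section TwistedCoefficients.
Variables (F : finFieldType) (L : fieldType) (j : {rmorphism F -> L}).
Local Notation q := #|F|.
Local Notation tw := (twpoly j).
Implicit Types (f u : tw) (c x y : L) (n : nat).

Fact twC_nmod : nmod_morphism (@twC F L j).
Proof. by split=> [|c x]; rewrite /twC ?polyCD. Qed.

Lemma twcoef_twCM c f n : twcoef (twC j c * f) n = c * twcoef f n.
Proof.
rewrite twcoefM big_ord_recl big1 => [|i _]; rewrite twcoefC /= ?mul0r //.
by rewrite expn0 expr1 subn0 addr0.
Qed.

Lemma twcoefMtwC c f n : twcoef (f * twC j c) n = twcoef f n * c ^+ (q ^ n).
Proof.
rewrite twcoefM big_ord_recr big1 => [|i _] /=; rewrite twcoefC.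
  by rewrite subnn /= add0r.
by rewrite subn_eq0 leqNgt ltn_ord /= qexp0 mulr0.
Qed.

Fact twC_monoid : monoid_morphism (@twC F L j).
Proof.
split=> // c x; apply: twpolyP => n.
by rewrite twcoef_twCM !twcoefC; case: eqP => _ //; rewrite mulr0.
Qed.

HB.instance Definition _ :=
  GRing.isNmodMorphism.Build L tw (@twC F L j) twC_nmod.
HB.instance Definition _ :=
  GRing.isMonoidMorphism.Build L tw (@twC F L j) twC_monoid.

Lemma twcoef_tau n : twcoef (tau j) n = (n == 1%N)%:R.
Proof. exact: coefX. Qed.

Lemma twcoefMtau f n :
  twcoef (f * tau j) n = if n is m.+1 then twcoef f m else 0.
Proof.
rewrite twcoefM big_ord_recr /= subnn twcoef_tau qexp0 mulr0 addr0.
case: n => [|n]; first by rewrite big_ord0.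
rewrite big_ord_recr /= subSnn twcoef_tau expr1n mulr1 big1 ?add0r // => i _.
by rewrite twcoef_tau subSn 1?ltnW // eqSS subn_eq0 leqNgt ltn_ord qexp0 mulr0.
Qed.

Lemma twcoef_tauM f n :
  twcoef (tau j * f) n = if n is m.+1 then twcoef f m ^+ q else 0.
Proof.
rewrite twcoefM big_ord_recl twcoef_tau mul0r add0r.
case: n => [|n]; first by rewrite big_ord0.
rewrite big_ord_recl twcoef_tau mul1r big1 ?addr0 => [|i _].
  by rewrite expn1 subSS subn0.
by rewrite twcoef_tau mul0r.
Qed.

Lemma twcoefB f u n : twcoef (f - u) n = twcoef f n - twcoef u n.
Proof. exact: coefB. Qed.

Lemma twcoef_sum (I : Type) (r : seq I) (P : pred I) (E : I -> tw) n :
  twcoef (\sum_(i <- r | P i) E i) n = \sum_(i <- r | P i) twcoef (E i) n.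
Proof.
by apply: (big_morph (fun f : tw => twcoef f n)) => [f u|];
  [exact: twcoefD|exact: coef0].
Qed.

Definition rank2 a x y : tw := twC j a + twC j x * tau j + twC j y * tau j ^+ 2.

Lemma twcoefMrank2 a x y f n : twcoef (f * rank2 a x y) n =
  twcoef f n * a ^+ (q ^ n)
  + (if n is m.+1 then twcoef f m * x ^+ (q ^ m) else 0)
  + (if n is m.+2 then twcoef f m * y ^+ (q ^ m) else 0).
Proof.
rewrite /rank2 expr2 !mulrDr !mulrA !twcoefD twcoefMtwC.
by case: n => [|[|n]]; rewrite !twcoefMtau ?twcoefMtwC.
Qed.

Lemma twcoef_rank2M a x y f n : twcoef (rank2 a x y * f) n =
  a * twcoef f n + (if n is m.+1 then x * twcoef f m ^+ q else 0)
  + (if n is m.+2 then y * twcoef f m ^+ (q ^ 2) else 0).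
Proof.
rewrite /rank2 expr2 !mulrDl -!mulrA !twcoefD !twcoef_twCM.
have q0 : (0 : L) ^+ q = 0 by rewrite -[q]expn1 qexp0.
by case: n => [|[|n]]; rewrite !twcoef_tauM ?q0 ?mulr0 // -exprM mulnn.
Qed.

Section Evaluation.
Variables (a x y : L).
Local Notation u := (rank2 a x y).
Local Notation ev f := (map_poly (@twC F L j) f).[u].

(** [ev] is not multiplicative, since u does not commute with constants. Coefficients stand on the
    left, so a factor 'X acts by right multiplication by u and a constant factor by left
    multiplication. *)
Lemma ev_mulXsubC (f : {poly L}) c :
  ev (f * ('X - c%:P)) = ev f * u - twC j c * ev f.
Proof.
rewrite mulrBr [f * c%:P]mulrC rmorphB /= hornerD hornerN.
by rewrite rmorphM /= map_polyX hornerMX rmorphM /= map_polyC hornerCM.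
Qed.

Lemma twcoef_ev_mulXsubC (f : {poly L}) c n :
  twcoef (ev (f * ('X - c%:P))) n =
  (a ^+ (q ^ n) - c) * twcoef (ev f) n
  + (if n is m.+1 then twcoef (ev f) m * x ^+ (q ^ m) else 0)
  + (if n is m.+2 then twcoef (ev f) m * y ^+ (q ^ m) else 0).
Proof.
by rewrite ev_mulXsubC twcoefB twcoef_twCM twcoefMrank2; case: n => [|[|n]]; ring.
Qed.

Lemma lrmorph_ev (phi : {lrmorphism {poly F} -> tw}) (p : {poly F}) :
  phi 'X = u -> phi p = ev (map_poly j p).
Proof.
move=> phiX; elim/poly_ind: p => [|p c IHp]; first by rewrite !rmorph0 horner0.
rewrite !rmorphD !rmorphM /= !map_polyX !map_polyC /= hornerD hornerMX hornerC.
rewrite IHp phiX -[c%:P]mulr1 mul_polyC linearZ rmorph1 /=; congr (_ + _).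
by apply: twpolyP => n; rewrite twcoefZ !twcoefC; case: eqP; rewrite ?mulr1 ?mulr0.
Qed.

(** The factor 'X - a^(q^m) kills the coefficient at tau^m, and right multiplication by u never
    lowers degrees; each new factor thus raises the order of vanishing by one. *)
Lemma ev_prod_low m n : (n < m)%N ->
  twcoef (ev (\prod_(i < m) ('X - (a ^+ (q ^ i))%:P))) n = 0.
Proof.
elim: m n => // m IHm n; rewrite ltnS => le_nm.
rewrite big_ord_recr twcoef_ev_mulXsubC /=.
have -> : (a ^+ (q ^ n) - a ^+ (q ^ m)) *
    twcoef (ev (\prod_(i < m) ('X - (a ^+ (q ^ i))%:P))) n = 0.
  move: le_nm; rewrite leq_eqVlt => /predU1P[->|/IHm ->].
    by rewrite subrr mul0r.
  by rewrite mulr0.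
by case: n le_nm => [|[|n]] le_nm; rewrite ?IHm ?mul0r ?addr0 // ltnW.
Qed.

Lemma ev_prod_hasse k :
  twcoef (ev (\prod_(i < k) ('X - (a ^+ (q ^ i.+1))%:P))) k
  = hasse_rec q a x y k.
Proof.
elim/nat_ind2: k => [||k IHk IHk1].
- by rewrite big_ord0 rmorph1 hornerC twcoefC.
- rewrite big_ord1 -['X - _]mul1r twcoef_ev_mulXsubC rmorph1 hornerC.
  by rewrite !twcoefC /= mulr0 mul1r add0r addr0.
rewrite big_ord_recr twcoef_ev_mulXsubC /= IHk1 subrr mul0r add0r.
rewrite hasse_recSS mulrC; congr (_ + _).
(* The product over 0 <= i <= k has no coefficient at tau^k. *)
have := ev_prod_low (ltnSn k); rewrite big_ord_recl expr1 mulrC.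
rewrite (eq_bigr (fun i : 'I_k => 'X - (a ^+ (q ^ i.+1))%:P)) // => low.
move: low; rewrite twcoef_ev_mulXsubC.
(* The factors 'X - a and 'X - a^(q^(k+1)) differ by the constant [k+1]. Appending the first to the
   product over 1 <= i <= k gives coefficient 0 at tau^k, so appending the second gives -[k+1]
   g_k. *)
rewrite big_ord_recr twcoef_ev_mulXsubC IHk /=.
move=> /(congr1 (fun z => z * y ^+ (q ^ k))); rewrite mul0r => low.
by apply/eqP; rewrite -subr_eq0 -[X in _ == X]low; apply/eqP; ring.
Qed.

Lemma Hcoef_hasse_rec (phi : {lrmorphism {poly F} -> tw}) (p : {poly F}) :
  phi 'X = u ->
  map_poly j p = \prod_(i < (size p).-1) ('X - (a ^+ (q ^ i))%:P) ->
  a ^+ (q ^ (size p).-1) = a ->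
  Hcoef p phi = hasse_rec q a x y (size p).-1.
Proof.
move=> phiX pE ad; rewrite -ev_prod_hasse /Hcoef (lrmorph_ev p phiX) pE.
congr (twcoef (ev _) _); case: (_.-1) ad => [|d] ad; first by rewrite !big_ord0.
(* Since a = a^(q^d), the factor at i = 0 may be moved to the end, which shifts the range to 1 <= i
   <= d. *)
by rewrite big_ord_recl [RHS]big_ord_recr /= ad expr1 mulrC.
Qed.

Lemma twcoef_rank2X n m : ((n.*2 < m)%N -> twcoef (u ^+ n) m = 0) /\
  twcoef (u ^+ n) n.*2 = y ^+ (\sum_(i < n) q ^ i.*2)%N.
Proof.
elim: n m => [|n IHn] m.
  rewrite big_ord0 !twcoefC /=; split=> //.
  by case: m.
split=> [|]; rewrite exprSr twcoefMrank2.
  case: m => [|[|m]] //; rewrite doubleS !ltnS => lt_nm.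
  by rewrite !(proj1 (IHn _)) ?mul0r ?addr0 //; lia.
rewrite doubleS (proj2 (IHn m)) !(proj1 (IHn _)) ?mul0r ?add0r //.
by rewrite big_ord_recr /= exprD.
Qed.

Lemma twcoef_lead (phi : {lrmorphism {poly F} -> tw}) (p : {poly F}) :
  phi 'X = u -> p \is monic ->
  twcoef (phi p) (size p).-1.*2 = y ^+ (\sum_(i < (size p).-1) q ^ i.*2)%N.
Proof.
move=> phiX p_monic; rewrite -[p in phi p]coefK poly_def rmorph_sum /=.
have p_gt0 : (0 < size p)%N by rewrite size_poly_gt0 monic_neq0.
have := monicP p_monic; rewrite lead_coefE twcoef_sum.
case: (size p) p_gt0 => //= d _ lead_p; rewrite big_ord_recr big1 /= => [|i _].
  rewrite add0r linearZ /= rmorphXn /= phiX twcoefZ lead_p.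
  by rewrite rmorph1 mul1r (proj2 (twcoef_rank2X _ 0)).
rewrite linearZ /= rmorphXn /= phiX twcoefZ (proj1 (twcoef_rank2X _ _)) ?mulr0 //.
by rewrite ltn_double.
Qed.

(** If all coefficients below tau^n vanish, comparing tau^n in f u = u f leaves [n] f_n = 0. Only at
    n = 0 and n = d may the bracket vanish, and there f_n = 0 is assumed. *)
Lemma twcoef_commute_low f d : f * u = u * f ->
  twcoef f 0 = 0 -> twcoef f d = 0 ->
  (forall n, (0 < n < d.*2)%N -> n != d -> brak q a n != 0) ->
  forall n, (n < d.*2)%N -> twcoef f n = 0.
Proof.
move=> fu f0 fd a_n n; elim/ltn_ind: n => n IHn lt_n.
have [-> //|n_gt0] := posnP n; have [-> //|nd] := eqVneq n d.
have := congr1 (fun g : tw => twcoef g n) fu.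
rewrite twcoefMrank2 twcoef_rank2M.
have low k : (k < n)%N -> twcoef f k = 0.
  by move=> lt_kn; apply: IHn => //; apply: ltn_trans lt_n.
have q0 : (0 : L) ^+ q = 0 by rewrite -[q]expn1 qexp0.
case: n n_gt0 lt_n nd low {IHn} => // -[|n] _ lt_n nd low /eqP.
  rewrite (low 0%N) // q0 mul0r mulr0 !addr0 -subr_eq0 mulrC -mulrBl.
  by rewrite mulf_eq0 (negPf (a_n 1%N _ _)) //= => /eqP.
rewrite (low n.+1) // (low n) // q0 qexp0 !mul0r !mulr0 !addr0 -subr_eq0 mulrC.
by rewrite -mulrBl mulf_eq0 (negPf (a_n n.+2 _ _)) //= => /eqP.
Qed.
End Evaluation.

Lemma rank2_factor a s :
  rank2 a (a + s) s = (twC j a + twC j s * tau j) * (1 + tau j).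
Proof.
rewrite /rank2 rmorphD /= expr2 mulrDr mulr1 !mulrDl -[_ * _ * tau j]mulrA.
by rewrite [RHS]addrACA !addrA.
Qed.

Lemma rank2_dual a s : rank2 a (s + a ^+ q) (s ^+ q) =
  (1 + tau j) * (twC j a + twC j s * tau j).
Proof.
rewrite mulrDl mul1r mulrDr [tau j * (_ * _)]mulrA !tau_twC.
by rewrite /rank2 rmorphD /= mulrDl expr2 !addrA mulrA.
Qed.
End TwistedCoefficients.

(** * The supersingular case: exchanging the two factors of phi_T *)

Lemma horner_alg_swap (F : fieldType) (A : algType F) (x y : A) (p : {poly F}) :
  x * horner_alg (y * x) p = horner_alg (x * y) p * x.
Proof.
elim/poly_ind: p => [|p c IHp]; first by rewrite !rmorph0 mulr0 mul0r.
rewrite !rmorphD !rmorphM /= !horner_algX !horner_algC mulrDr mulrDl.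
by rewrite !mulrA IHp mulr_algl mulr_algr.
Qed.

(* [horner_alg u] is linear for the scaling [in_alg \; *%R]; this copy is     *)
(* linear for [*:%R].                                                         *)
Definition poly_eval (F : fieldType) (A : algType F) (u : A) : {poly F} -> A :=
  horner_alg u.

Section PolyEval.
Variables (F : fieldType) (A : algType F) (u : A).

Fact poly_eval_scalable : scalable (poly_eval u).
Proof.
move=> c f; rewrite /poly_eval -mul_polyC rmorphM /= horner_algC.
exact: mulr_algl.
Qed.

HB.instance Definition _ :=
  GRing.RMorphism.copy (poly_eval u) (horner_alg u).
HB.instance Definition _ :=
  GRing.isScalable.Build F {poly F} A *:%R (poly_eval u) poly_eval_scalable.

Lemma poly_evalX : poly_eval u 'X = u.
Proof. exact: horner_algX. Qed.
End PolyEval.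

Lemma brak_qpow_period (F : finFieldType) (L : fieldType) (a : L) d n :
  a ^+ (#|F| ^ d) = a -> (d <= n)%N -> brak #|F| a n = brak #|F| a (n - d).
Proof. by move=> ad le_dn; rewrite /brak -{1}(subnKC le_dn) expnD exprM ad. Qed.

Lemma supersingular_qpow_fixed (F : finFieldType) (L : fieldType)
    (j : {rmorphism F -> L}) (p : {poly F}) (a l : L) :
  let q := #|F| in let d := (size p).-1 in
  p \is monic -> (0 < d)%N ->
  map_poly j p = \prod_(i < d) ('X - (a ^+ (q ^ i))%:P) ->
  a ^+ (q ^ d) = a ->
  (forall n, (0 < n < d)%N -> brak q a n != 0) ->
  hasse_rec q a (a + l ^+ (q + 1)) (l ^+ (q + 1)) d = 0 ->
  l ^+ (q ^ (d * 2)) = l.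
Proof.
move=> q d p_monic d_gt0 pE ad a_n.
set s := l ^+ (q + 1) => ss.
have q0 : (0 : L) ^+ q = 0 by rewrite -[q]expn1 qexp0.
pose M : twpoly j := 1 + tau j; pose N : twpoly j := twC j a + twC j s * tau j.
pose phi : {lrmorphism {poly F} -> twpoly j} := poly_eval (N * M).
pose psi : {lrmorphism {poly F} -> twpoly j} := poly_eval (M * N).
have phiX : phi 'X = rank2 j a (a + s) s by rewrite rank2_factor; exact: poly_evalX.
have psiX : psi 'X = rank2 j a (s + a ^+ q) (s ^+ q).
  by rewrite rank2_dual; exact: poly_evalX.
have phi_low n : (n < d.*2)%N -> twcoef (phi p) n = 0.
  apply: (twcoef_commute_low (x := a + s) (y := s) (a := a)).
  - by rewrite -phiX -!rmorphM mulrC.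
  - rewrite (lrmorph_ev _ phiX) pE; exact: ev_prod_low.
  - by rewrite -[LHS]/(Hcoef p phi) (Hcoef_hasse_rec phiX pE ad).
  move=> m /andP[m_gt0 lt_m] nmd.
  have [le_md|lt_dm] := leqP m d; first by rewrite a_n // m_gt0 ltn_neqAle nmd.
  by rewrite (brak_qpow_period ad (ltnW lt_dm)) a_n //; lia.
have swap n : twcoef (psi p) n
    + (if n is m.+1 then twcoef (psi p) m else 0)
  = twcoef (phi p) n + (if n is m.+1 then twcoef (phi p) m ^+ q else 0).
  have sw : M * phi p = psi p * M := horner_alg_swap M N p.
  have := congr1 (fun g : twpoly j => twcoef g n) sw.
  by rewrite mulrDl mulrDr mul1r mulr1 !twcoefD twcoef_tauM twcoefMtau => ->.
(* M has constant term 1, so psi_p M and psi_p start in the same degree, and vanishing below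
   tau^(2d) passes from phi_p to psi_p. *)
have psi_low n : (n < d.*2)%N -> twcoef (psi p) n = 0.
  elim: n => [|n IHn] lt_n; have := swap _.
    by move/(_ 0%N); rewrite phi_low // !addr0.
  by move/(_ n.+1); rewrite IHn ?(phi_low n) ?phi_low ?q0 ?addr0 //; apply: ltnW.
have := swap d.*2; rewrite (twcoef_lead phiX p_monic) (twcoef_lead psiX p_monic).
rewrite -/d; set S := (\sum_(i < d) q ^ i.*2)%N.
have -> : d.*2 = d.*2.-1.+1 by rewrite prednK // double_gt0.
rewrite phi_low ?psi_low ?prednK ?double_gt0 // q0 !addr0 -!exprM => lS.
have [->|l0] := eqVneq l 0; first exact: qexp0.
have q_gt0 : (0 < q)%N by apply/card_gt0P; exists 0.
(* This is (q^2 - 1) S = q^(2d) - 1 written without subtraction. Combined with s^S = s^(q S) for s =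
   l^(q+1), it gives l^(q^(2d)) = l after cancelling l^((q+1) S). *)
have expS : (q ^ (d * 2) + (q + 1) * S = 1 + (q + 1) * (q * S))%N.
  have := predn_exp (q ^ 2) d.
  rewrite -expnM mulnC (eq_bigr (fun i : 'I_d => (q ^ i.*2)%N)) -/S; last first.
    by move=> i _; rewrite -expnM mul2n.
  have : (0 < q ^ (d * 2))%N by rewrite expn_gt0 q_gt0.
  rewrite -[(q ^ 2)%N]mulnn; by clear -q_gt0; case: (q) q_gt0 => // q' _; nia.
have : l ^+ (q ^ (d * 2) + (q + 1) * S) = l ^+ (1 + (q + 1) * (q * S)).
  by rewrite expS.
by rewrite !exprD expr1 lS => /mulIf -> //; rewrite expf_neq0.
Qed.

(** * Degree and separability of the Hasse polynomial *)

Lemma card_finField_gt1 (F : finFieldType) : (1 < #|F|)%N.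
Proof. by apply/card_gt1P; exists 0, 1; rewrite // eq_sym oner_neq0. Qed.

Lemma natr_card_eq0 (F : finFieldType) (R : nzRingType)
  (j : {rmorphism F -> R}) : #|F|%:R = 0 :> R.
Proof.
have [p p_pr pF] := finPcharP F.
have := card_finField_gt1 F; rewrite (card_pprimeChar pF) natrX.
rewrite -(rmorph_nat j) (pcharf0 pF) rmorph0 expr0n.
by case: eqP => // ->.
Qed.

Section HassePolynomial.
Variables (F : finFieldType) (k : fieldType) (j : {rmorphism F -> k}) (a : k).
Local Notation q := #|F|.
Local Notation H := (hasse_rec q a%:P (a%:P + 'X) 'X : nat -> {poly k}).

Lemma horner_hasse_poly (K : fieldType) (iota : {rmorphism k -> K}) x n :
  (map_poly iota (H n)).[x] = hasse_rec q (iota a) (iota a + x) x n.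
Proof.
rewrite -[LHS]/(horner_eval x (map_poly iota (H n))) !rmorph_hasse_rec /=.
by rewrite rmorphD /= map_polyX map_polyC /= /horner_eval !hornerE.
Qed.

Lemma hasse_polySS n : H n.+2 = (a%:P + 'X) ^+ (q ^ n.+1) * H n.+1
  - (brak q a n.+1)%:P * 'X^(q ^ n) * H n.
Proof. by rewrite hasse_recSS -polyC_exp -polyCB. Qed.

(** The second term of the recursion has degree at most q^n + (1 + ... + q^(n-1)), below the degree
    of the first term, so no cancellation occurs at the top. *)
Lemma size_hasse_poly n : size (H n) = (\sum_(i < n) q ^ i).+1.
Proof.
elim/nat_ind2: n => [||n IHn IHn1].
- by rewrite big_ord0 size_poly1.
- by rewrite big_ord1 addrC size_XaddC.
have q_gt0 i : (0 < q ^ i)%N := qexp_gt0 F i.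
have sizeA : size ((a%:P + 'X) ^+ (q ^ n.+1) * H n.+1)
             = (\sum_(i < n.+2) q ^ i).+1.
  rewrite size_mul -?size_poly_gt0 ?IHn1 //; last first.
    by rewrite size_poly_gt0 expf_neq0 // -size_poly_gt0 addrC size_XaddC.
  rewrite -[a]opprK polyCN addrC size_exp_XsubC.
  by rewrite [in RHS]big_ord_recr /=; lia.
rewrite hasse_polySS size_polyDl sizeA // size_polyN.
apply: leq_ltn_trans (size_polyMleq _ _) _; rewrite IHn addnS /=.
have : (size ((brak q a n.+1)%:P * 'X^(q ^ n))%R <= (q ^ n).+1)%N.
  rewrite mul_polyC; apply: leq_trans (size_scale_leq _ _) _.
  by rewrite size_polyXn.
rewrite !big_ord_recr /= => le_s; rewrite ltnS -addnA addnC leq_add2l.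
by rewrite (leq_trans le_s) // -addn1 leq_add2l.
Qed.

Lemma deriv_qpowS (f : {poly k}) n : (f ^+ (q ^ n.+1))^`() = 0.
Proof.
rewrite deriv_exp -mulr_natr natrX exprS.
by rewrite (natr_card_eq0 (polyC \o j)) mul0r mulr0.
Qed.

(** The index starts at three because in [H 2] the factor 'X^(q^0) is 'X itself, whose derivative is
    not zero. *)
Lemma deriv_hasse_polySSS n : (H n.+3)^`() =
  (a%:P + 'X) ^+ (q ^ n.+2) * (H n.+2)^`()
  - (brak q a n.+2)%:P * 'X^(q ^ n.+1) * (H n.+1)^`().
Proof.
by rewrite hasse_polySS derivB !derivM !deriv_qpowS derivC !(mul0r, mulr0, add0r).
Qed.

Lemma hasse_poly_casoratian n : a != 0 ->
  (forall i, (0 < i < n.+2)%N -> brak q a i != 0) ->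
  exists2 c, c != 0 & exists m,
    H n.+2 * (H n.+1)^`() - (H n.+2)^`() * H n.+1 = c%:P * 'X^m.
Proof.
move=> a0; elim: n => [|n IHn] a_n.
  (* The value comes from H_1 = a + X and H_2 = (a + X)^(q+1) - [1] X. *)
  exists (a * brak q a 1); first by rewrite mulf_neq0 // a_n.
  exists 0%N; rewrite hasse_polySS derivB !derivM deriv_qpowS derivC.
  rewrite -[H 1]/(a%:P + 'X) -[H 0]/(1 : {poly k}) expn0 !expn1 derivD derivC.
  have -> : (a%:P + 'X) ^+ q = (a ^+ q)%:P + 'X^q :> {poly k}.
    rewrite polyC_exp exprDn_pchar // (eq_pnat _ (pchar_lalg _)).
    by rewrite -[q]expn1 (card_pchar_nat j).
  rewrite derivX derivC /brak expn1 polyCM polyCB polyC_exp; ring.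
have [i|c c0 [m Wn]] := IHn.
  by case/andP=> i_gt0 lt_i; apply: a_n; rewrite i_gt0 ltnW.
(* As H and its derivative obey the same recursion here, one step multiplies the Casoratian by [n+2]
   X^(q^(n+1)). *)
exists (brak q a n.+2 * c); first by rewrite mulf_neq0 // a_n /=.
exists (q ^ n.+1 + m)%N; rewrite deriv_hasse_polySSS hasse_polySS.
rewrite polyCM exprD mulrACA -Wn; ring.
Qed.

Lemma hasse_poly_root0 (K : fieldType) (iota : {rmorphism k -> K}) n :
  a != 0 -> ~~ root (map_poly iota (H n)) 0.
Proof.
move=> a0; rewrite /root horner_hasse_poly addr0.
have ia0 : iota a != 0 by rewrite fmorph_eq0.
elim/nat_ind2: n => [|//|n _ IHn1]; first exact: oner_neq0.
by rewrite hasse_recSS qexp0 mulr0 mul0r subr0 mulf_neq0 // expf_neq0.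
Qed.

Lemma hasse_poly_no_multiple_root n : a != 0 -> (0 < n)%N ->
  (forall i, (0 < i < n)%N -> brak q a i != 0) -> no_multiple_root (H n).
Proof.
move=> a0 n_gt0 a_n K iota _ x; apply/negP => /dvdpP[r rE].
have Hx : (map_poly iota (H n)).[x] = 0.
  by rewrite rE hornerM horner_exp hornerXsubC subrr expr0n mulr0.
have H'x : (map_poly iota (H n)^`()).[x] = 0.
  rewrite -deriv_map rE expr2 !derivM !(hornerXsubC, hornerD, hornerM) subrr.
  by rewrite !(mul0r, mulr0, addr0).
(* The Casoratian pairs H_n with H_(n-1) only for n >= 2; H_1 = a + X has derivative 1. Otherwise
   the monomial must vanish at x, which forces x = 0. *)
case: n n_gt0 a_n Hx H'x {rE} => // -[_ _ _|n _ a_n Hx H'x].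
  rewrite -[H 1]/(a%:P + 'X) derivD derivC derivX add0r rmorph1 hornerC.
  by apply/eqP; exact: oner_neq0.
have [c c0 [m W]] := hasse_poly_casoratian a0 a_n.
have := congr1 (fun f => (map_poly iota f).[x]) W.
rewrite rmorphB !rmorphM /= map_polyC map_polyXn hornerD hornerN !hornerM.
rewrite Hx H'x !mul0r subr0 hornerC hornerXn => /esym/eqP.
rewrite mulf_eq0 fmorph_eq0 (negPf c0) expf_eq0 => /andP[_ /eqP x0].
by have := hasse_poly_root0 iota n.+2 a0; rewrite /root -[X in _.[X]]x0 Hx eqxx.
Qed.
End HassePolynomial.

(** * The quadratic extension of a finite field *)

Section QuadraticExtension.
Variables (F : finFieldType) (k : fieldExtType F).
Local Notation Q := (#|F| ^ \dim {:k})%N.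

Lemma fieldExt_qpow (c : k) : c ^+ Q = c.
Proof. by apply/eqP; rewrite -Fermat's_little_theorem memvf. Qed.

Lemma card_qpow_gt1 : (1 < Q)%N.
Proof.
by rewrite -(exp1n (\dim {:k})) ltn_exp2r ?card_finField_gt1 // adim_gt0.
Qed.

Lemma fieldExt_genPoly :
  exists s : seq k, 'X^Q - 'X = \prod_(c <- s) ('X - c%:P).
Proof.
pose s : seq k := enum (finvect_type k); exists s.
have size_s : size s = Q.
  transitivity #|finvect_type k|; first by rewrite cardT.
  rewrite -[RHS](card_vspace (fullv : {vspace finvect_type k})).
  by apply: eq_card => c; rewrite [RHS]memvf.
have sizeQ : size ('X^Q - 'X : {poly k}) = Q.+1.
  by rewrite size_polyDl size_polyXn // size_polyN size_polyX ltnS card_qpow_gt1.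
rewrite (@all_roots_prod_XsubC _ ('X^Q - 'X) s) ?sizeQ ?size_s //.
- rewrite lead_coefDl ?lead_coefXn ?scale1r //.
  by rewrite size_polyN size_polyX size_polyXn ltnS card_qpow_gt1.
- by apply/allP => c _; rewrite /root !hornerE fieldExt_qpow subrr.
by rewrite uniq_rootsE; exact: (enum_uniq (finvect_type k)).
Qed.

Variables (K : closedFieldType) (iota : {rmorphism k -> K}).

Lemma qpow_fixed_image (x : K) : x ^+ Q = x -> exists c, x = iota c.
Proof. by have [s gen] := fieldExt_genPoly; apply: fixed_pow_descent gen. Qed.

Let qpowD (x y : K) : (x + y) ^+ Q = x ^+ Q + y ^+ Q.
Proof. exact: (qexpD (iota \o GRing.in_alg k)). Qed.

Let Q_gt0 : (0 < Q)%N. Proof. exact: qexp_gt0. Qed.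

(** The polynomial with roots mu and mu^Q has coefficients fixed by the Q-power map, hence in k. It
    has no root in k, as mu is not fixed, so it is irreducible and E is its root field. *)
Lemma quadratic_generator (mu : K) :
  mu ^+ Q != mu -> mu ^+ Q ^+ Q = mu ->
  exists (E : fieldExtType k) (e : {rmorphism E -> K}),
    [/\ \dim {:E} = 2%N, forall c : k, e c%:A = iota c & exists y, mu = e y].
Proof.
move=> muQ muQQ; pose f : {poly K} := ('X - mu%:P) * ('X - (mu ^+ Q)%:P).
have size_f : size f = 3%N.
  by rewrite size_mul ?polyXsubC_eq0 // !size_XsubC.
have fE : f = 'X^2 + (- (mu + mu ^+ Q)) *: 'X + (mu * mu ^+ Q)%:P.
  by rewrite /f -mul_polyC polyCN polyCD polyCM; ring.
have NQ (x : K) : (- x) ^+ Q = - x ^+ Q.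
  by apply/eqP; rewrite -subr_eq0 opprK -qpowD addNr expr0n gtn_eqF.
have [i|r rE] := @map_poly_descent _ _ iota f.
  apply: qpow_fixed_image; rewrite fE !(coefD, coefXn, coefZ, coefX, coefC).
  case: i => [|[|[|i]]] /=; rewrite !(mulr0, mulr1, add0r, addr0).
  - by rewrite exprMn muQQ mulrC.
  - by rewrite NQ qpowD muQQ addrC.
  - exact: expr1n.
  by rewrite expr0n gtn_eqF.
have size_r : size r = 3%N by rewrite -(size_map_poly iota) -rE.
have r_irr : irreducible_poly r.
  apply: cubic_irreducible; first by rewrite size_r.
  move=> c; apply/negP => rc.
  have : root f (iota c) by rewrite rE fmorph_root.
  rewrite rootM !root_XsubC => /orP[] /eqP cmu.
    by move: muQ; rewrite -cmu -rmorphXn /= fieldExt_qpow eqxx.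
  by move: muQ; rewrite -{2}muQQ -cmu -rmorphXn /= fieldExt_qpow eqxx.
have rmu : root (map_poly iota r) mu by rewrite -rE rootM root_XsubC eqxx.
have r0 : r != 0 by rewrite -size_poly_gt0 size_r.
exists (SubFieldExtType rmu r_irr), (@subfx_inj k K iota mu r); split.
- by rewrite dimvf /dim /= size_r.
- by move=> c; exact: subfx_inj_base.
by exists (subfx_root iota mu r); exact: esym (subfx_inj_root rmu r0).
Qed.

(** An Artin-Schreier construction: choose y with y^(Q-1) = -1, so y^Q = -y, then mu with mu^Q = mu
    + y. The next power gives mu + y - y = mu. *)
Lemma quadratic_generator_exists :
  exists mu : K, mu ^+ Q != mu /\ mu ^+ Q ^+ Q = mu.
Proof.
have Q_gt1 := card_qpow_gt1.
have [|y] := closed_rootP ('X^(Q.-1) + 1%:P : {poly K}) _.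
  by rewrite size_XnaddC; lia.
rewrite /root !hornerE => /eqP yQ1.
have y0 : y != 0.
  by apply: contra_eq_neq yQ1 => ->; rewrite expr0n gtn_eqF ?add0r ?oner_neq0; lia.
have yQ : y ^+ Q = - y.
  rewrite -(prednK Q_gt0) exprSr; apply/eqP; rewrite -subr_eq0 opprK.
  by rewrite -[X in _ + X]mul1r -mulrDl yQ1 mul0r.
have [|mu] := closed_rootP ('X^Q - ('X + y%:P) : {poly K}) _.
  by rewrite size_polyDl size_polyXn; [lia|rewrite size_polyN size_XaddC; lia].
rewrite /root !hornerE subr_eq0 => /eqP muQ; exists mu.
rewrite muQ qpowD muQ yQ addrK; split=> //.
by rewrite -subr_eq0 addrAC subrr add0r.
Qed.

Lemma qpow2_in_quadratic_ext (x : K) :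
  x ^+ Q ^+ Q = x -> in_quadratic_ext iota x.
Proof.
move=> xQQ; have [xQ|xQ] := eqVneq (x ^+ Q) x; last exact: quadratic_generator.
(* Here x comes from k, but the extension must have degree exactly two, so one generated by an
   auxiliary mu is taken. *)
have [mu [muQ muQQ]] := quadratic_generator_exists.
have [E [e [dimE eE _]]] := quadratic_generator muQ muQQ.
have [c ->] := qpow_fixed_image xQ.
by exists E, e; split=> //; exists c%:A; rewrite eE.
Qed.
End QuadraticExtension.

(** * Assembly over the residue field of p *)

Lemma sum_expn_divn q d : (1 < q)%N ->
  (\sum_(i < d) q ^ i = (q ^ d - 1) %/ (q - 1))%N.
Proof. by move=> q_gt1; rewrite !subn1 predn_exp mulKn //; lia. Qed.

Lemma root_irreducible_neq0 (F : fieldType) (K : fieldExtType F) (p : {poly F})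
    (a : K) : p \is monic -> irreducible_poly p -> p != 'X ->
  root (map_poly (GRing.in_alg K) p) a -> a != 0.
Proof.
move=> p_monic p_irr p_neqX pa; apply: contraNneq p_neqX => a0.
move: pa; rewrite a0 -(rmorph0 (GRing.in_alg K)) fmorph_root => p0.
have Xp : 'X %| p by rewrite -['X]subr0 dvdp_XsubCl.
by rewrite eq_sym -eqp_monic ?monicX //; apply: p_irr => //; rewrite size_polyX.
Qed.

Theorem mainTheorem1
    (F : finFieldType)
    (p : {poly F}) (p_monic : p \is monic) (p_irr : irreducible_poly p)
    (p_neqX : p != 'X)
    (Fp : fieldExtType F) (alpha : Fp)
    (alpha_root : root (map_poly (GRing.in_alg Fp) p) alpha)
    (Fp_gen : <<1; alpha>>%VS = {:Fp}%VS) :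
  let q := #|F| in
  let d := (size p).-1 in
  (forall (L : fieldType) (iota : {rmorphism Fp -> L}) (A1 A2 : L)
      (phi : {lrmorphism {poly F} -> twpoly (iota \o GRing.in_alg Fp)}),
    drinfeld_rank2 (iota alpha) A1 A2 phi ->
    Hcoef p phi =
      \sum_(S <- Ppairs d)
        Lprod q (iota alpha) (fshift S.2 1) * A1 ^+ wt q S.1 * A2 ^+ wt q S.2)
  /\
  (let K := {fraction {poly Fp}} in
   let iota : {rmorphism Fp -> K} := @tofrac {poly Fp} \o polyC in
   let lambda : K := tofrac 'X in
   forall phi : {lrmorphism {poly F} -> twpoly (iota \o GRing.in_alg Fp)},
    drinfeld_rank2 (iota alpha) (iota alpha + lambda) lambda phi ->
    exists H : {poly Fp},
      [/\ Hcoef p phi = tofrac H,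
          no_multiple_root H,
          size H = ((q ^ d - 1) %/ (q - 1)).+1
        & forall (Fbar : closedFieldType) (jbar : {rmorphism Fp -> Fbar}),
            alg_closure jbar ->
            forall l : Fbar, root (map_poly jbar H) (l ^+ (q + 1)) ->
              in_quadratic_ext jbar l]).
Proof.
move=> q d; have [d_gt0 alpha_d] : (0 < d)%N /\ alpha ^+ (q ^ d) = alpha.
  by split; [case: p_irr; rewrite /d; case: (size p) => [|[]]|
             exact: (root_qpow_period p_irr alpha_root Fp_gen)].
have alpha_n n : (0 < n < d)%N -> brak q alpha n != 0.
  exact: (brak_neq0 p_irr alpha_root).
have pE (L : fieldType) (iota : {rmorphism Fp -> L}) :
    map_poly (iota \o GRing.in_alg Fp) p
    = \prod_(i < d) ('X - (iota alpha ^+ (q ^ i))%:P).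
  rewrite map_poly_comp (irreducible_qpow_factor p_monic p_irr alpha_root Fp_gen).
  by rewrite map_prod_XsubC; under eq_bigr => i _ do rewrite rmorphXn.
have HE (L : fieldType) (iota : {rmorphism Fp -> L}) (A1 A2 : L)
    (phi : {lrmorphism {poly F} -> twpoly (iota \o GRing.in_alg Fp)}) :
    drinfeld_rank2 (iota alpha) A1 A2 phi ->
    Hcoef p phi = hasse_rec q (iota alpha) A1 A2 d.
  case=> _ phiX; apply: Hcoef_hasse_rec phiX (pE _ _) _.
  by rewrite -rmorphXn alpha_d.
split=> [L iota A1 A2 phi /HE ->|]; first by rewrite sum_Ppairs.
move=> K iota lambda phi /HE ->.
have alpha0 : alpha != 0 := root_irreducible_neq0 p_monic p_irr p_neqX alpha_root.
have dimFp : \dim {:Fp} = d := dim_irreducible p_irr alpha_root Fp_gen.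
exists (hasse_rec q alpha%:P (alpha%:P + 'X) 'X d); split.
- by rewrite rmorph_hasse_rec rmorphD.
- exact: (hasse_poly_no_multiple_root (GRing.in_alg Fp)).
- by rewrite size_hasse_poly sum_expn_divn // card_finField_gt1.
move=> Fbar jbar _ l; rewrite /root horner_hasse_poly => /eqP l_ss.
(* As Fp has degree d over F, applying its Q-power map twice is raising to the power q^(2d). *)
apply: qpow2_in_quadratic_ext; rewrite dimFp -exprM -expnD addnn -muln2.
apply: (supersingular_qpow_fixed p_monic d_gt0 (pE _ jbar)) l_ss.
  by rewrite -rmorphXn alpha_d.
by move=> n /alpha_n; rewrite /brak -rmorphXn -rmorphB fmorph_eq0.
Qed.
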